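(* Let $T=(V,E)$ be a tree and let $S\subset V$. Then $S$ is a resolving set of $T^{3}$ if and only if all of the following five conditions hold: (1) for every pair $u,v\in V$ with $d_T(u,v)=1$, $S$ contains a vertex $x$ with $\min\{d_T(x,u),d_T(x,v)\}\equiv 0 \pmod 3$; (2) for every pair $u,v\in V$ with $d_T(u,v)=2$, $S$ contains a vertex $x\in T_u\cup T_v$ with $\min\{d_T(x,u),d_T(x,v)\}\equiv 0$ or $2 \pmod 3$; (3) for every pair $u,v\in V$ with $d_T(u,v)=3$, $S$ contains a vertex $x$ such that either $x\in T_u\cup T_v$ (so that $|d_T(x,u)-d_T(x,v)|=3$), or $\min\{d_T(x,u),d_T(x,v)\}\equiv 0\pmod 3$; (4) for every pair $u,v\in V$ with $d_T(u,v)=4$, $S$ contains a vertex $x$ such that either $x\in T_u\cup T_v$ (so that $|d_T(x,u)-d_T(x,v)|=4$), or $d_T(x,u)\neq d_T(x,v)$ and $\min\{d_T(x,u),d_T(x,v)\}\equiv 0$ or $2\pmod 3$; (5) for every pair $u,v\in V$ with $d_T(u,v)=5$, $S$ contains a vertex $x$ such that either $x\in T_u\cup T_v$ (so that $|d_T(x,u)-d_T(x,v)|=5$), or $|d_T(x,u)-d_T(x,v)|=3$, or $\min\{d_T(x,u),d_T(x,v)\}\equiv 0\pmod 3$.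
   Context: All graphs are finite, simple, undirected and connected; $d_G(u,v)$ is the length of a shortest path between $u$ and $v$ in $G$. A vertex $s$ resolves two distinct vertices $u,v$ of $G$ if $d_G(s,u)\neq d_G(s,v)$. A set $S\subseteq V(G)$ is a resolving set of $G$ if every two distinct vertices of $G$ are resolved by some $s\in S$. For a tree $T=(V,E)$, the cube of $T$ is the graph $T^3$ on the vertex set $V$ in which two distinct vertices $u,v$ are adjacent if and only if $d_T(u,v)\le 3$; thus $d_{T^3}(u,v)=\lceil d_T(u,v)/3\rceil$. For distinct vertices $u,v$ of $T$, let $u_1$ be the neighbour of $u$ and $v_1$ the neighbour of $v$ on the $u$–$v$ path of $T$ (if $d_T(u,v)=1$ then $u_1=v$ and $v_1=u$). $T_u$ denotes the component containing $u$ of $T$ minus the edge $uu_1$, and $T_v$ the component containing $v$ of $T$ minus the edge $v_1v$. We write $x\in T_u$ for $x\in V(T_u)$; in particular $u\in T_u$ and $v\in T_v$. *)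

(* Defs.v *)
From mathcomp Require Import all_boot ssrint.

Set Implicit Arguments.
Unset Strict Implicit.
Unset Printing Implicit Defensive.

Section Graphs.

Variable V : finType.
Implicit Types (e : rel V) (u v w x y s : V) (S : {set V}).

Definition simple_graph e : Prop := symmetric e /\ irreflexive e.

Definition connected_graph e : Prop :=
  0 < #|V| /\ forall x y, connect e x y.

(* The bound on the size excludes the 2-cycles [:: x; y] coming from the two
   orientations of an edge. *)
Definition acyclic e : Prop := forall c : seq V, ucycle e c -> size c <= 2.

Definition is_tree e : Prop :=
  [/\ simple_graph e, connected_graph e & acyclic e].

Definition walk e x y (n : nat) : bool :=
  [exists p : n.-tuple V, path e x p && (last x p == y)].

(* Shortest walks have length < #|V|; the value is the junk value #|V| when y
   cannot be reached from x. *)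
Definition gdist e x y : nat := find (walk e x y) (iota 0 #|V|).

Lemma walkP e x y n :
  reflect (exists p, [/\ path e x p, last x p = y & size p = n]) (walk e x y n).
Proof.
apply: (iffP existsP) => [[p /andP[pp /eqP lp]]|[p [pp lp sp]]].
  by exists p; rewrite size_tuple.
by move/eqP: sp => sp; exists (Tuple sp); rewrite /= pp lp eqxx.
Qed.

Lemma gdist_min e x p : path e x p -> gdist e x (last x p) <= size p.
Proof.
move=> pp; rewrite leqNgt; apply/negP => lt_p.
have lt_V : size p < #|V|.
  by apply: leq_trans lt_p _; rewrite -[X in _ <= X](size_iota 0) find_size.
have := before_find 0 lt_p; rewrite nth_iota // add0n => /negbT/negP; apply.
by apply/walkP; exists p.
Qed.

Lemma gdist_path e x y : connect e x y ->
  exists p, [/\ path e x p, last x p = y & size p = gdist e x y].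
Proof.
case/connectP=> p0 /shortenP[p pp Up _] ->; apply/walkP.
have sp : size p < #|V|.
  by rewrite -[_.+1]/(size (x :: p)) -(card_uniqP Up) max_card.
have h : has (walk e x (last x p)) (iota 0 #|V|).
  apply/hasP; exists (size p); first by rewrite mem_iota.
  by apply/walkP; exists p.
have := nth_find 0 h; rewrite nth_iota ?add0n //.
by move: h; rewrite has_find size_iota.
Qed.

Definition graph_cube e : rel V :=
  [rel u v | (u != v) && (gdist e u v <= 3)].

Definition resolves e s u v : bool := gdist e s u != gdist e s v.

Definition resolving_set e S : Prop :=
  forall u v, u != v -> exists2 s, s \in S & resolves e s u v.

(* w is the neighbour of u on a simple path from u to v; in a tree there is
   exactly one such w for distinct u and v. *)
Definition next_on_path e u v w : Prop :=
  exists p, [/\ path e u (w :: p), uniq (u :: w :: p) & last w p = v].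

Definition del_edge e u w : rel V :=
  [rel x y | e x y && ([set x; y] != [set u; w])].

(* For distinct vertices u and v of a tree, x \in T_u is in_branch e u v x and
   x \in T_v is in_branch e v u x. *)
Definition in_branch e u v x : Prop :=
  exists2 w, next_on_path e u v w & connect (del_edge e u w) u x.

Definition in_branches e u v x : Prop := in_branch e u v x \/ in_branch e v u x.

End Graphs.

(* Main.v *)
Require Import Defs.
From mathcomp Require Import all_boot ssrint.
From mathcomp Require Import zify.

(* A vertex s resolves u and v in the cube of T iff the distances of s to u and
   to v have different ceilings after division by 3. When s is attached to the
   u-v path at distance i from u, its distances to u and v differ by
   |d(u,v) - 2i|, so for d(u,v) <= 5 the conditions (1)-(5) only spell this out.
   For larger d(u,v) they already imply resolution: from d(u,v) >= 7 one
   shortens the path by 3 at both ends, and d(u,v) = 6 follows from two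
   applications of (2), the second one to a pair of neighbours of a vertex w of
   the path of which one lies off the path. *)

Set Implicit Arguments.
Unset Strict Implicit.
Unset Printing Implicit Defensive.

(** * Geodesics in a connected graph and distances in its cube *)

Section Distance.

Variables (V : finType) (e : rel V).
Hypotheses (e_sym : symmetric e) (e_conn : forall x y, connect e x y).
Implicit Types u v w x y : V.

Local Notation d := (gdist e).

Lemma gdist_geodesic x y :
  exists p, [/\ path e x p, last x p = y & size p = d x y].
Proof. exact: gdist_path. Qed.

Lemma gdistxx x : d x x = 0.
Proof. by apply/eqP; rewrite -leqn0 (@gdist_min _ e x [::]). Qed.

Lemma gdist_eq0 x y : d x y = 0 -> x = y.
Proof. by have [[|z p] [_ <- <-]] := gdist_geodesic x y. Qed.

Lemma gdist_sym x y : d x y = d y x.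
Proof.
suff le_d z t : d z t <= d t z by apply/eqP; rewrite eqn_leq !le_d.
have [p [pp <- <-]] := gdist_geodesic t z.
have -> : size p = size (rev (belast t p)) by rewrite size_rev size_belast.
have -> : d (last t p) t = d (last t p) (last (last t p) (rev (belast t p))).
  by case: p {pp} => //= a p; rewrite rev_cons last_rcons.
apply: gdist_min; rewrite rev_path.
by rewrite (@eq_path _ _ e) // => a b; rewrite e_sym.
Qed.

Lemma gdist_triangle y x z : d x z <= d x y + d y z.
Proof.
have [p [pp lp <-]] := gdist_geodesic x y.
have [q [pq <- <-]] := gdist_geodesic y z.
rewrite -size_cat -lp -last_cat; apply: gdist_min.
by rewrite cat_path pp lp.
Qed.

Lemma gdist_edge x y : e x y -> d x y <= 1.
Proof. by move=> exy; apply: (@gdist_min _ e x [:: y]); rewrite /= exy. Qed.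

Lemma gdist_between x y i : i <= d x y ->
  exists z, d x z = i /\ d z y = d x y - i.
Proof.
move=> le_i; have [p [pp lp sp]] := gdist_geodesic x y.
pose z := last x (take i p); exists z.
have [p1 p2] : path e x (take i p) /\ path e z (drop i p).
  by apply/andP; rewrite -cat_path cat_take_drop.
have l2 : last z (drop i p) = y by rewrite -last_cat cat_take_drop.
have := gdist_min p1; have := gdist_min p2; rewrite l2 -/z.
rewrite size_drop size_takel sp //.
by have := gdist_triangle z x y; lia.
Qed.

Lemma gdist_next x y : x != y -> exists2 z, e x z & d x y = (d z y).+1.
Proof.
move=> neq; have [[|z p] [pp lp sp]] := gdist_geodesic x y.
  by rewrite -lp eqxx in neq.
case/andP: pp => exz pz; exists z => //; apply/eqP; rewrite eqn_leq.
rewrite -{2}sp -lp !ltnS (gdist_min pz) andbT.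
by apply: leq_trans (gdist_triangle z _ _) _; rewrite -add1n leq_add2r gdist_edge.
Qed.

Lemma cube_path_gdist x p :
  path (graph_cube e) x p -> d x (last x p) <= 3 * size p.
Proof.
elim: p x => [|y p IH] x /=; first by rewrite gdistxx.
case/andP=> /andP[_ le3] /IH le_y.
by have := gdist_triangle y x (last y p); lia.
Qed.

(** A geodesic is cut greedily into strides of length three, with one shorter stride at the end. *)
Lemma gdist_cube_path x y n : d x y <= 3 * n ->
  exists p, [/\ path (graph_cube e) x p, last x p = y & size p <= n].
Proof.
elim: n x => [|n IH] x le_d.
  by exists [::]; split=> //=; apply: gdist_eq0; lia.
have [le3|gt3] := leqP (d x y) 3.
  have [->|neq] := eqVneq x y; first by exists [::].
  by exists [:: y]; split=> //; rewrite /graph_cube /= neq le3.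
have [z [dxz dzy]] : exists z, d x z = 3 /\ d z y = d x y - 3.
  by apply: gdist_between; lia.
have [|p [pp lp sp]] := IH z; first by lia.
exists (z :: p); split=> //=; rewrite pp /graph_cube /= dxz !andbT.
by apply/eqP => xz; rewrite xz gdistxx in dxz.
Qed.

(** The right-hand side is the ceiling of a third of [d x y]: one cube step advances by at most
    three, and strides of three attain this bound. *)
Lemma gdist_cube x y : gdist (graph_cube e) x y = (d x y + 2) %/ 3.
Proof.
have le_d : d x y <= 3 * ((d x y + 2) %/ 3) by lia.
have [p [pp lp sp]] := gdist_cube_path le_d.
have xy : connect (graph_cube e) x y by apply/connectP; exists p.
have [q [pq lq sq]] := gdist_path xy.
have := cube_path_gdist pq; have := gdist_min pp; rewrite lp lq.
by lia.
Qed.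

End Distance.

(** * Trees: sides of an edge, branches and parity *)

Section Tree.

Variables (V : finType) (T : rel V).
Hypothesis hT : is_tree T.
Implicit Types u v w x y : V.

Local Notation d := (gdist T).

Lemma tree_sym : symmetric T.
Proof. by case: hT => -[]. Qed.

Lemma tree_conn x y : connect T x y.
Proof. by case: hT => _ [_]. Qed.

Local Notation dxx := (gdistxx T).
Local Notation d_sym := (gdist_sym tree_sym tree_conn).
Local Notation d_tri := (gdist_triangle tree_conn).

Lemma gdist_tree_edge u w : T u w -> d u w = 1.
Proof.
move=> uw; apply/eqP; rewrite eqn_leq gdist_edge // lt0n.
apply: contraTneq uw => /(gdist_eq0 tree_conn) ->.
by case: hT => -[_ ->].
Qed.

Lemma del_edge_sym u w : symmetric (del_edge T u w).
Proof. by move=> x y; rewrite /del_edge /= tree_sym setUC. Qed.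

Lemma del_edgeC u w x y : del_edge T u w x y = del_edge T w u x y.
Proof. by rewrite /del_edge /= [[set u; w]]setUC. Qed.

Lemma del_connectC u w x y :
  connect (del_edge T u w) x y = connect (del_edge T w u) x y.
Proof. by apply: eq_connect => a b; apply: del_edgeC. Qed.

(** A simple path from [u] to [w] that avoids the edge would close up with it to a cycle on at least
    three vertices. *)
Lemma tree_bridge u w : T u w -> ~~ connect (del_edge T u w) u w.
Proof.
move=> uw; apply/negP => /connectP[p0 /shortenP[p pp Up _] lw].
have /(_ (u :: p)) : acyclic T by case: hT.
have Tp : path T u p by apply: sub_path pp => x y /andP[].
move=> H; have {}H : size (u :: p) <= 2.
  by apply: H; rewrite /ucycle /= rcons_path Tp -lw tree_sym uw; exact: Up.
case: p pp lw H {Up Tp} => [|y [|z p]] //=.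
  by move=> _ wu; move: uw; rewrite wu; case: hT => -[_ ->].
by move=> /andP[/andP[_ /eqP neq] _] wy _; apply: neq; rewrite wy.
Qed.

Lemma path_avoid_del u w x p : path T x p -> u \notin x :: p ->
  path (del_edge T u w) x p.
Proof.
elim: p x => //= y p IH x /andP[xy py]; rewrite !inE !negb_or.
case/and3P=> ux uy up; rewrite IH // ?inE ?negb_or ?uy //.
rewrite /del_edge /= xy andbT; apply/eqP => E.
by have := set21 u w; rewrite -E !inE (negbTE ux) (negbTE uy).
Qed.

(** As [uw] is a bridge, a geodesic from [w] to the side of [u] must begin with the step to [u]. *)
Lemma side_gdist u w x : T u w -> connect (del_edge T u w) u x ->
  d w x = (d u x).+1.
Proof.
move=> uw ux; have wu : T w u by rewrite tree_sym.
apply/eqP; rewrite eqn_leq; apply/andP; split.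
  by have := d_tri u w x; rewrite (gdist_tree_edge wu).
have [p0 [pp0 lp0 <-]] := gdist_geodesic tree_conn w x.
(* Once simple, the walk never returns to [w], so everything after its first step avoids the deleted
   edge. *)
case/shortenP: pp0 lp0 => p pp Up sub lx.
have /andP[wp up] := Up.
apply: leq_trans (uniq_leq_size up sub).
case: p pp wp lx {Up sub up} => [|y p] /=.
  by move=> _ _ wx; move: ux; rewrite -wx (negbTE (tree_bridge uw)).
move=> /andP[wy py] wyp lx.
have [yu|neq_yu] := eqVneq y u.
  by rewrite ltnS -lx -yu; apply: gdist_min.
case/negP: (tree_bridge uw); apply: connect_trans ux _.
rewrite (sym_connect_sym (del_edge_sym u w)).
apply: (@connect_trans _ _ y); last first.
  apply/connectP; exists p; last by [].
  by rewrite (eq_path (del_edgeC u w)) path_avoid_del.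
apply: connect1; rewrite /del_edge /= wy; apply/eqP => E.
have : y \in [set u; w] by rewrite -E set22.
rewrite !inE (negbTE neq_yu) => /eqP yw.
by rewrite yw mem_head in wyp.
Qed.

Lemma tree_sides u w x : T u w ->
  connect (del_edge T u w) u x \/ connect (del_edge T u w) w x.
Proof.
move=> uw; have [p [+ + _]] := gdist_geodesic tree_conn x u.
elim: p x => [|y p IH] x /=; first by move=> _ ->; left.
move=> /andP[xy py] /(IH _ py) yS.
have [E|ne] := eqVneq [set x; y] [set u; w].
  by have := set21 x y; rewrite E !inE => /orP[] /eqP ->; [left|right].
have yx : connect (del_edge T u w) y x.
  by apply: connect1; rewrite del_edge_sym /del_edge /= xy ne.
by case: yS => h; [left|right]; apply: connect_trans h yx.
Qed.

(** Being on a given side of an edge becomes an equation between distances, which linear arithmetic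
    can use. Conversely, the other side would force the opposite equation. *)
Lemma sideE u w x : T u w ->
  reflect (d x w = (d x u).+1) (connect (del_edge T u w) u x).
Proof.
move=> uw; apply: (iffP idP) => [ux|E].
  by rewrite ![d x _]d_sym (side_gdist uw).
case: (tree_sides x uw) => // wx.
have wu : T w u by rewrite tree_sym.
rewrite del_connectC in wx; have := side_gdist wu wx.
by rewrite [d u x]d_sym [d w x]d_sym E; lia.
Qed.

Lemma edge_gdist u w x : T u w -> d x w = (d x u).+1 \/ d x u = (d x w).+1.
Proof.
move=> uw; have wu : T w u by rewrite tree_sym.
case: (tree_sides x uw) => [/(sideE _ uw)|]; first by left.
by rewrite del_connectC => /(sideE _ wu); right.
Qed.

(* A geodesic from x to v has to use the bridge uw. *)
Lemma crossing_gdist u w x v : T u w -> d x w = (d x u).+1 ->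
  d v u = (d v w).+1 -> d x v = d x u + (d w v).+1.
Proof.
move=> uw xS vS; have wu : T w u by rewrite tree_sym.
apply/eqP; rewrite eqn_leq; apply/andP; split.
  have := d_tri u x v; have := d_tri w u v.
  by rewrite (gdist_tree_edge uw); lia.
have [p [+ + <-]] := gdist_geodesic tree_conn x v.
elim: p x xS => [|y p IH] x xS /=; first by move=> _ E; rewrite E in xS; lia.
move=> /andP[xy py] lp.
case: (edge_gdist y uw) => [yS|yS].
  have := IH y yS py lp; have := d_tri y x u.
  by rewrite (gdist_tree_edge xy); lia.
have [E|ne] := eqVneq [set x; y] [set u; w]; last first.
  case/negP: (tree_bridge uw); apply: (@connect_trans _ _ x).
    exact/sideE.
  apply: (@connect_trans _ _ y).
    by apply: connect1; rewrite /del_edge /= xy ne.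
  rewrite (sym_connect_sym (del_edge_sym u w)) del_connectC.
  exact/sideE.
(* The geodesic crosses the bridge here, so [x] is [u] and [y] is [w]. *)
have := set21 x y; have := set22 x y; rewrite E !inE.
case/orP=> /eqP yE; first by rewrite yE dxx in yS.
case/orP=> /eqP xE; last by rewrite xE dxx in xS.
rewrite xE dxx add0n ltnS -lp -yE.
exact: gdist_min.
Qed.

(* Deleting a vertex w of the u-v path separates u from v. *)
Lemma tree_between u v w x : d u w + d w v = d u v ->
  d x u = d x w + d w u \/ d x v = d x w + d w v.
Proof.
move=> uwv; have [<-|neq] := eqVneq w v; first by right; rewrite dxx addn0.
(* The edge from [w] towards [v] serves as bridge: from its [w] side [v] is reached through [w],
   from its other side [u] is. *)
have [z wz dwv] := gdist_next tree_conn neq.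
have uz : d u z = (d u w).+1.
  by case: (edge_gdist u wz) => // E; have := d_tri z u v; lia.
case: (edge_gdist x wz) => E.
  by right; rewrite (crossing_gdist wz E) ?[d v _]d_sym // dwv.
left; rewrite [d x u]d_sym (crossing_gdist wz uz E) [d w u]d_sym.
by rewrite [d z x]d_sym -E addnC.
Qed.

(** Trees are bipartite: moving [u] along an edge changes both [d x u] and [d u v] by one. Hence the
    distances from [x] to [u] and [v] differ by a number of the parity of [d u v]. *)
Lemma gdist_parity x u v : ~~ odd (d x u + d u v + d x v).
Proof.
have [p [+ + _]] := gdist_geodesic tree_conn u v.
elim: p u => [|y p IH] u /=; first by move=> _ ->; rewrite dxx; lia.
move=> /andP[uy py] /(IH _ py).
by case: (edge_gdist x uy); case: (edge_gdist v uy); rewrite ![d v _]d_sym; lia.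
Qed.

(** Translates branches into distances, so that conditions (1)-(5) become arithmetic. *)
Lemma in_branchP u v x : u != v ->
  in_branch T u v x <-> d x v = d x u + d u v.
Proof.
move=> neq; split.
  case=> w [p [/= /andP[uw pp] /andP[nu Up] lp]] /(sideE _ uw) xS.
  have wu : T w u by rewrite tree_sym.
  have vS : d v u = (d v w).+1.
    apply/(sideE _ wu); apply/connectP; exists p => //.
    by rewrite -(eq_path (del_edgeC u w)) path_avoid_del.
  by rewrite (crossing_gdist uw xS vS) [d u v]d_sym vS [d v w]d_sym.
have [w uw duv] := gdist_next tree_conn neq => E.
exists w; last first.
  apply/(sideE _ uw); case: (edge_gdist x uw) => // xw.
  by have := d_tri w x v; lia.
have [p0 [pp0 lp0 sp0]] := gdist_geodesic tree_conn w v.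
case/shortenP: pp0 lp0 => p pp Up sub lp; exists p; split=> //.
  by rewrite /= uw.
(* If [u] were on this path, the part from [u] to [v] would already have length at least [d u v],
   more than [d w v]. *)
rewrite cons_uniq Up andbT; apply/negP => up.
have := uniq_leq_size (proj2 (andP Up)) sub.
case/splitPl: up pp lp => p1 p2 l1; rewrite cat_path last_cat l1.
case/andP=> _ p2P l2; have := gdist_min p2P; rewrite l2 size_cat.
move=> le1 le2; have := leq_trans le1 (leq_trans (leq_addl _ _) le2).
by rewrite sp0 duv ltnn.
Qed.

Lemma in_branchesP u v x : u != v ->
  in_branches T u v x <-> d x v = d x u + d u v \/ d x u = d x v + d u v.
Proof.
move=> neq; rewrite /in_branches in_branchP // in_branchP 1?eq_sym //.
by rewrite [d v u]d_sym.
Qed.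

Lemma resolves_cubeE s u v :
  resolves (graph_cube T) s u v = ((d s u + 2) %/ 3 != (d s v + 2) %/ 3).
Proof. by rewrite /resolves !(gdist_cube tree_conn). Qed.

(* A vertex s that does not resolve u and v is attached near the middle of the
   u-v path, so moving both ends three steps inwards lowers both distances
   from s by exactly three. *)
Lemma resolved_shift u v u' v' s : 6 < d u v -> d u u' = 3 ->
  d u' v = d u v - 3 -> d u' v' = d u v - 6 -> d v' v = 3 ->
  resolves (graph_cube T) s u' v' -> resolves (graph_cube T) s u v.
Proof.
move=> gt6 uu' u'v u'v' v'v; rewrite !resolves_cubeE.
have uv' : d u v' = d u v - 3.
  by have := d_tri u' u v'; have := d_tri v' u v; lia.
have := @tree_between u v u' s; have := @tree_between u v v' s.
have := d_tri u s u'; have := d_tri v s v'.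
rewrite [d u' u]d_sym [d v v']d_sym [d v' u]d_sym uu' u'v uv' v'v.
(* If one of the two distances does not drop by three, parity makes [d s u] and [d s v] differ by at
   least three, which always separates the ceilings. *)
have := gdist_parity s u v; have := d_tri u' s u; have := d_tri v' s v.
rewrite [d u' u]d_sym uu' v'v.
by lia.
Qed.

(** * Pairs at distance six, by condition (2) *)

Section Six.

Variable S : {set V}.
Hypothesis S_two : forall u v, d u v = 2 -> exists2 x, x \in S &
  in_branches T u v x /\ (minn (d x u) (d x v) = 0 %[mod 3] \/
                          minn (d x u) (d x v) = 2 %[mod 3]).

Lemma gdist_neq u v n : d u v = n.+1 -> u != v.
Proof. by move=> E; apply/eqP => uv; rewrite uv dxx in E. Qed.

(* An unresolving s attached at w is at distance 2 mod 3 from w. Condition (2)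
   for the two neighbours of w towards u and towards s gives some y in S that
   either resolves u and v, or is attached at w through the same branch as s
   and then is also at distance 2 mod 3 from w, against condition (2). *)
Lemma six_no_side u v w s : d u v = 6 -> d u w = 2 -> d w v = 4 ->
  (forall x, x \in S -> ~~ resolves (graph_cube T) x u v) ->
  s \in S -> d s v <> d s w + 4.
Proof.
move=> uv uw wv nres sS sv.
have nres' y : y \in S -> (d y u + 2) %/ 3 = (d y v + 2) %/ 3.
  by move/nres; rewrite resolves_cubeE negbK => /eqP.
have tri x y z : d x z <= d x y + d y z by exact: d_tri.
have su2 : d s u = d s w + 2 /\ d s w %% 3 = 2.
  by have := nres' s sS; have := tri s w u; rewrite [d w u]d_sym uw sv; lia.
case: su2 => su sw3.
have [q wq swq] : exists2 q, T w q & d w s = (d q s).+1.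
  apply: gdist_next; first exact: tree_conn.
  by apply: contraTneq isT => ws; rewrite ws dxx in sw3.
(* Here [p] is the neighbour of [w] towards [u], and [q] the one towards [s]. They are distinct
   because [s] reaches [u] through [w]. *)
have [p [up pw]] : exists p, d u p = 1 /\ d p w = d u w - 1.
  by apply: (gdist_between tree_conn); rewrite uw.
have dwq := gdist_tree_edge wq.
have pq : d p q = 2.
  move: (tri p w q) (tri s p u) (tri s q p).
  rewrite [d q p]d_sym [d p u]d_sym up [d s q]d_sym.
  by move: swq su; rewrite [d w s]d_sym; lia.
have pv : d p v = 5.
  by have := tri u p v; have := tri p w v; lia.
have qv : d q v = 5.
  move: swq (tri s q v) (tri q w v).
  by rewrite [d q w]d_sym [d s q]d_sym [d w s]d_sym; lia.
have qu : d q u = 3.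
  move: swq (tri s q u) (tri q w u).
  by rewrite [d q w]d_sym [d s q]d_sym [d w s]d_sym [d w u]d_sym; lia.
have [y yS [/(in_branchesP _ (gdist_neq pq)) yB ymod]] := S_two pq.
have := nres' y yS.
have := @tree_between p q w y; have := @tree_between p v w y.
have := @tree_between q v w y; have := @tree_between q u w y.
move: (tri y w p) (tri y w q) (tri y p u) (tri y w v) (tri y w u).
rewrite [d q w]d_sym [d w u]d_sym [d p u]d_sym [d w p]d_sym.
by move: yB ymod; rewrite pq; lia.
Qed.

(** Let [w] and [z] be the path vertices at distances 2 and 4 from [u]. Condition (2) for them
    yields some [s] beyond [w] or beyond [z], hence at distance [d s w + 4] from [v] or [d s z + 4]
    from [u]. Without resolution, [six_no_side] excludes both. *)
Lemma six_resolved u v : d u v = 6 ->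
  exists2 s, s \in S & resolves (graph_cube T) s u v.
Proof.
move=> uv.
case: (@exists_inP _ (mem S) (fun s => resolves (graph_cube T) s u v)) => //.
move=> nex.
have nres x : x \in S -> ~~ resolves (graph_cube T) x u v.
  by move=> xS; apply/negP => xr; apply: nex; exists x.
have [w [uw wv]] : exists w, d u w = 2 /\ d w v = d u v - 2.
  by apply: (gdist_between tree_conn); rewrite uv.
have [z [wz zv]] : exists z, d w z = 2 /\ d z v = d w v - 2.
  by apply: (gdist_between tree_conn); lia.
have uz : d u z = 4 by have := d_tri w u z; have := d_tri z u v; lia.
have [s sS [/(in_branchesP _ (gdist_neq wz)) sB _]] := S_two wz.
have := @six_no_side u v w s uv uw _ nres sS.
have := @six_no_side v u z s; rewrite [d v u]d_sym [d v z]d_sym [d z u]d_sym.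
have nres2 x : x \in S -> ~~ resolves (graph_cube T) x v u.
  by move/nres; rewrite /resolves eq_sym.
move/(_ uv _ uz nres2 sS).
have := @tree_between w v z s; have := @tree_between u z w s.
rewrite [d z w]d_sym [d w u]d_sym.
by lia.
Qed.

End Six.

End Tree.

(** * The equivalence with conditions (1)-(5) *)

Theorem theorem4p1 (V : finType) (T : rel V) (hT : is_tree T) (S : {set V}) :
  resolving_set (graph_cube T) S <->
  [/\ (forall u v : V, gdist T u v = 1 ->
         exists2 x, x \in S &
           minn (gdist T x u) (gdist T x v) = 0 %[mod 3]),
      (forall u v : V, gdist T u v = 2 ->
         exists2 x, x \in S &
           in_branches T u v x /\
           (minn (gdist T x u) (gdist T x v) = 0 %[mod 3] \/
            minn (gdist T x u) (gdist T x v) = 2 %[mod 3])),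
      (forall u v : V, gdist T u v = 3 ->
         exists2 x, x \in S &
           in_branches T u v x \/
           minn (gdist T x u) (gdist T x v) = 0 %[mod 3]),
      (forall u v : V, gdist T u v = 4 ->
         exists2 x, x \in S &
           in_branches T u v x \/
           (gdist T x u <> gdist T x v /\
            (minn (gdist T x u) (gdist T x v) = 0 %[mod 3] \/
             minn (gdist T x u) (gdist T x v) = 2 %[mod 3])))
    & (forall u v : V, gdist T u v = 5 ->
         exists2 x, x \in S &
           [\/ in_branches T u v x,
               `|gdist T x u - gdist T x v|%N = 3
             | minn (gdist T x u) (gdist T x v) = 0 %[mod 3]])].
Proof.
have resE := resolves_cubeE hT; have brE := in_branchesP hT.
have par := gdist_parity hT; have conn := tree_conn hT.
have tri x y z : gdist T x z <= gdist T x y + gdist T y z.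
  exact: gdist_triangle.
have dS := gdist_sym (tree_sym hT) conn.
split=> [Sres|[S1 S2 S3 S4 S5] u v].
  (* Necessity: the vertex resolving [u] and [v] is itself the witness, by parity and the triangle
     inequality. *)
  split=> u v uv; have neq := gdist_neq uv; have [s sS] := Sres u v neq;
    rewrite resE => sr; exists s => //; move: (par s u v) (tri s u v) (tri s v u);
    rewrite ?brE // [gdist T v u]dS uv.
  1-4: by lia.
  - move=> h1 h2 h3; have [h|[h|h]] :
       (gdist T s v = gdist T s u + 5 \/ gdist T s u = gdist T s v + 5) \/
       (`|gdist T s u - gdist T s v|%N = 3 \/
       minn (gdist T s u) (gdist T s v) = 0 %[mod 3]) by lia.
    + by constructor 1; apply/brE; rewrite ?uv.
    + by constructor 2.
    + by constructor 3.
(* Sufficiency goes by strong induction on the distance; only distances above six call the induction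
   hypothesis. *)
have [n] := ubnP (gdist T u v); elim: n u v => // n IH u v le_n neq.
have duv : gdist T u v != 0.
  by apply: contraNneq neq => /(gdist_eq0 conn) ->.
have [gt6|le6] := ltnP 6 (gdist T u v).
  have [u' [uu' u'v]] : exists z, gdist T u z = 3 /\
      gdist T z v = gdist T u v - 3.
    by apply: gdist_between => //; lia.
  have [v' [u'v' v'v]] : exists z, gdist T u' z = gdist T u v - 6 /\
      gdist T z v = gdist T u' v - (gdist T u v - 6).
    by apply: gdist_between => //; lia.
  (* The inner ends stay distinct because their distance [gdist T u v - 6] is positive. *)
  have [||s sS sr] := IH u' v'; first by lia.
    by apply/eqP => E; move: u'v'; rewrite E gdistxx; lia.
  by exists s => //; apply: (resolved_shift hT gt6 uu' u'v u'v') sr; lia.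
have [d6|d6] := eqVneq (gdist T u v) 6; first exact: six_resolved.
have : [\/ gdist T u v = 1, gdist T u v = 2, gdist T u v = 3
          | gdist T u v = 4 \/ gdist T u v = 5].
  by move: le6 duv d6; case: (gdist T u v) => [|[|[|[|[|[|[|k]]]]]]] // _ _ _;
    constructor; auto.
(* A difference of at least three always separates the ceilings. A difference of two does so when
   the minimum is 0 or 2 mod 3, a difference of one when it is 0 mod 3. *)
case=> [uv|uv|uv|[uv|uv]].
- have [s sS sP] := S1 u v uv; exists s => //; rewrite resE.
  by move: (par s u v) (tri s u v) (tri s v u) sP; rewrite [gdist T v u]dS uv; lia.
- have [s sS [/(brE _ _ _ neq) sB sP]] := S2 u v uv; exists s => //; rewrite resE.
  by move: sB sP; rewrite uv; lia.
- have [s sS sP] := S3 u v uv; exists s => //; rewrite resE.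
  rewrite brE // in sP.
  by move: (par s u v) (tri s u v) (tri s v u) sP; rewrite [gdist T v u]dS uv; lia.
- have [s sS sP] := S4 u v uv; exists s => //; rewrite resE.
  rewrite brE // in sP.
  by move: (par s u v) (tri s u v) (tri s v u) sP; rewrite [gdist T v u]dS uv; lia.
- have [s sS sP] := S5 u v uv; exists s => //; rewrite resE.
  move: (par s u v) (tri s u v) (tri s v u); rewrite [gdist T v u]dS uv.
  by case: sP => [/(brE _ _ _ neq)||]; rewrite ?uv; lia.
Qed.
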